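(* Let $\Gamma=\langle X,p,I,J,G\rangle$ be a repeated game with incomplete information on one side with a finite state space $X$, $|X|=d$. Then for every positive integer $k$, $$v_k(p)-(\mathrm{cav}\,u)(p)\le \|G\|\sqrt{\frac{2H(p)}{k}}\le \|G\|\sqrt{\frac{2\log d}{k}},$$ where $(\mathrm{cav}\,u)(p)=\lim_{n\to\infty}v_n(p)$.
   Context: $\log$ is the natural logarithm. For a finite set $X$, $\Delta(X)$ is the set of $p\in\mathbb{R}^X$ with $p(x)\ge 0$ and $\sum_{x}p(x)=1$, and $H(p)=-\sum_{x\in X}p(x)\log p(x)$ is the entropy, with $0\log0=0$. A (two-person zero-sum) repeated game with incomplete information on one side $\Gamma=\langle X,p,I,J,G\rangle$ consists of a state space $X$, a probability $p\in\Delta(X)$, finite nonempty sets of stage actions $I$ for player 1 (P1) and $J$ for player 2 (P2), and a list $G=(G^x)_{x\in X}$ of real $I\times J$ matrices, where $G^x_{i,j}$ is the payoff from P2 to P1 when in state $x$ the action pair $(i,j)$ is played. $\|G\|:=\max_{x,i,j}|G^x_{i,j}|$. The $k$-stage game $\Gamma_k(p)$: nature chooses $x\in X$ according to $p$ ($p$ is commonly known); P1 is informed of $x$, P2 is not. At each stage $1\le t\le k$, P1 chooses $i_t\in I$ and simultaneously P2 chooses $j_t\in J$; both choices are observed by both players after stage $t$. P1's choice of $i_t$ may depend on $x,i_1,j_1,\ldots,i_{t-1},j_{t-1}$, and P2's choice of $j_t$ may depend on $i_1,j_1,\ldots,i_{t-1},j_{t-1}$. Strategies $\sigma$ of P1 and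 $\tau$ of P2 (mixed or behavioral) together with $p$ define a probability distribution on plays $x,i_1,j_1,\ldots,i_k,j_k$, with expectation $E_{\sigma,\tau}$. The payoff is $\bar g_k=\frac1k\sum_{t=1}^kG^x_{i_t,j_t}$, and the value is $v_k(p):=\max_\sigma\min_\tau E_{\sigma,\tau}\bar g_k$. For fixed $X,I,J,G$ and $q\in\Delta(X)$, $u(q)$ is the minmax value (in mixed strategies) of the matrix game $\sum_{x}q(x)G^x$, and $\mathrm{cav}\,u$ is the least concave function on $\Delta(X)$ that is greater than or equal to $u$. It is a known theorem of Aumann and Maschler that $v_k(p)\ge(\mathrm{cav}\,u)(p)$ for all $k$ and $v_k(p)\to(\mathrm{cav}\,u)(p)$ as $k\to\infty$. *)

(* Defs.v *)
From HB Require Import structures.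
From mathcomp Require Import all_boot all_order all_algebra.
From mathcomp Require Import all_classical all_reals all_analysis.
Set Implicit Arguments.
Unset Strict Implicit.
Unset Printing Implicit Defensive.
Import Order.TTheory GRing.Theory Num.Theory.
Import numFieldNormedType.Exports.
Local Open Scope classical_set_scope.
Local Open Scope ring_scope.

(* The set Delta(T) of probability vectors on a finite set T. *)
Definition simplex (R : realType) (T : finType) : set (T -> R) :=
  [set q | (forall x, 0 <= q x) /\ \sum_x q x = 1].
Arguments simplex : clear implicits.

(* Since ln 0 = 0, the convention 0 log 0 = 0 holds. *)
Definition entropy (R : realType) (X : finType) (p : X -> R) : R :=
  - \sum_x p x * ln (p x).

(* All the terms are nonnegative, so that the default value 0 of the iterated
   maximum is harmless. *)
Definition payoff_norm (R : realType) (X I J : finType)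
    (G : X -> I -> J -> R) : R :=
  \big[Num.max/0]_x \big[Num.max/0]_i \big[Num.max/0]_j `|G x i j|.

(** The k-stage game *)

(* Behavioral strategies.  A history is the sequence of the action pairs of the
   past stages, oldest first; P1 moreover knows the state. *)
Definition strategies1 (R : realType) (X I J : finType) :
    set (X -> seq (I * J) -> I -> R) :=
  [set s | forall x h, simplex R I (s x h)].
Arguments strategies1 : clear implicits.

Definition strategies2 (R : realType) (I J : finType) :
    set (seq (I * J) -> J -> R) :=
  [set t | forall h, simplex R J (t h)].
Arguments strategies2 : clear implicits.

(* The probability of the play (x, h).  The two players randomize independently
   at each stage; take n h is the history before the stage numbered n, where
   stages are numbered from 0 to k - 1. *)
Definition play_prob (R : realType) (X I J : finType) (p : X -> R)
    (s : X -> seq (I * J) -> I -> R) (t : seq (I * J) -> J -> R)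
    (k : nat) (x : X) (h : k.-tuple (I * J)) : R :=
  p x * \prod_(n < k) (s x (take n h) (tnth h n).1 *
                       t (take n h) (tnth h n).2).

Definition mean_payoff (R : realType) (X I J : finType) (G : X -> I -> J -> R)
    (k : nat) (x : X) (h : k.-tuple (I * J)) : R :=
  k%:R^-1 * \sum_(n < k) G x (tnth h n).1 (tnth h n).2.

Definition expected_payoff (R : realType) (X I J : finType)
    (G : X -> I -> J -> R) (p : X -> R) (k : nat)
    (s : X -> seq (I * J) -> I -> R) (t : seq (I * J) -> J -> R) : R :=
  \sum_x \sum_(h : k.-tuple (I * J))
    play_prob p s t x h * mean_payoff G x h.

(* The value v_k(p) = max_s min_t E_(s,t).  For nonempty I and J, all the sets
   of reals involved are nonempty and bounded, and the extrema are attained by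
   compactness. *)
Definition game_value (R : realType) (X I J : finType) (G : X -> I -> J -> R)
    (k : nat) (p : X -> R) : R :=
  sup [set inf [set expected_payoff G p k s t | t in strategies2 R I J]
      | s in strategies1 R X I J].

(** The nonrevealing game *)

Definition mixed_payoff (R : realType) (I J : finType) (A : I -> J -> R)
    (a : I -> R) (b : J -> R) : R :=
  \sum_i \sum_j a i * A i j * b j.

(* The extrema are attained here too. *)
Definition minmax_value (R : realType) (I J : finType) (A : I -> J -> R) : R :=
  inf [set sup [set mixed_payoff A a b | a in simplex R I]
      | b in simplex R J].

Definition nonrevealing_value (R : realType) (X I J : finType)
    (G : X -> I -> J -> R) (q : X -> R) : R :=
  minmax_value (fun i j => \sum_x q x * G x i j).

(** Concavification *)

Definition concave_on_simplex (R : realType) (X : finType)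
    (f : (X -> R) -> R) : Prop :=
  forall (q r : X -> R) (c : R),
    simplex R X q -> simplex R X r -> 0 <= c <= 1 ->
    c * f q + (1 - c) * f r <= f (fun x => c * q x + (1 - c) * r x).

Definition concave_majorant (R : realType) (X : finType)
    (u f : (X -> R) -> R) : Prop :=
  concave_on_simplex f /\ (forall q, simplex R X q -> u q <= f q).

(* The least concave majorant of u on the simplex; see cavP. *)
Definition cav (R : realType) (X : finType) (u : (X -> R) -> R)
    (q : X -> R) : R :=
  inf [set f q | f in concave_majorant u].

Lemma cavP (R : realType) (X : finType) (u : (X -> R) -> R) (M : R) :
  (forall q, simplex R X q -> u q <= M) ->
  concave_majorant u (cav u) /\
  (forall f, concave_majorant u f ->
     forall q, simplex R X q -> cav u q <= f q).
Proof.
move=> uM.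
have lbS q : simplex R X q -> lbound [set f q | f in concave_majorant u] (u q).
  by move=> sq _ [f [_ fu] <-]; exact: fu.
have neS q : [set f q | f in concave_majorant u] !=set0.
  exists M, (fun=> M) => //; split=> // q' r c _ _ _.
  by rewrite -mulrDl addrC subrK mul1r.
have le_cav f q : concave_majorant u f -> simplex R X q -> cav u q <= f q.
  move=> fu sq; apply: ge_inf; last by exists f.
  by exists (u q); exact: lbS.
split; last by move=> f fu q sq; exact: le_cav.
split; last by move=> q sq; apply: lb_le_inf; [exact: neS|exact: lbS].
move=> q r c sq sr /[dup] c01 /andP[c0 c1].
apply: lb_le_inf; first exact: neS.
move=> _ [f fu <-]; apply: le_trans (fu.1 _ _ _ sq sr c01).
apply: lerD; apply: ler_wpM2l; rewrite ?subr_ge0 //; exact: le_cav.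
Qed.

(* Main.v *)
Require Import Defs.
From HB Require Import structures.
From mathcomp Require Import all_boot all_order all_algebra.
From mathcomp Require Import all_classical all_reals all_analysis.
From mathcomp Require Import ring lra.
Set Implicit Arguments.
Unset Strict Implicit.
Unset Printing Implicit Defensive.
Import Order.TTheory GRing.Theory Num.Theory.
Import numFieldNormedType.Exports.
Local Open Scope classical_set_scope.
Local Open Scope ring_scope.

(** The value lies between cav u(p) and cav u(p) plus the stated error.

    Upper bound.  Fix a strategy of P1.  After every history P2 computes the
    posterior on the states, which does not depend on his own randomization, and
    plays a nearly optimal mixed action of the nonrevealing game at that
    posterior.  If the action of P1 were independent of the state given the
    history, then the stage payoff would be at most u at the posterior, and the
    posteriors average to p, so that by concavity (concave_jensen) the mean of
    u at the posterior is at most cav u(p).  The loss is at most the norm of G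
    times the l1 distance between the joint law of state and action and the
    product of its conditional marginals (stage_payoff_le).  By Pinsker's
    inequality the square of this distance is at most twice the mutual
    information of the stage, that is the decrease of the conditional entropy
    of the state (joint_product_dist_sqr_le).  These decreases telescope to at
    most H(p) (sum_joint_product_dist_sqr), and the mean of the k distances is at
    most their quadratic mean, whence sqrt (2 H(p) / k).

    Lower bound.  Ignoring his information and playing a nearly optimal mixed
    action at every stage, P1 obtains nearly u(p); as u is an inf sup, this needs the minimax
    theorem (minimax_mixed_action), which follows from a regret argument.
    Moreover v_k is concave: if p is a mixture of q and r, then P1 can simulate
    the lottery between two strategies, one good at q and one good at r, by a
    single behavioral strategy (splitting_strategy).  A concave function above u
    is above cav u.  Both bounds together give the limit. *)

(** * Pinsker's inequality and the entropy bound *)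

Lemma is_derive_pinsker (R : realType) (u : R) : 0 < u ->
  is_derive u 1 (fun v : R => ln v + 4^-1 * v^-1 + 27 / 4 * (v + 2)^-1 - 5 / 2)
    ((u - 1) ^+ 3 / (u ^+ 2 * (u + 2) ^+ 2)).
Proof.
move=> u0.
have un0 : u != 0 by rewrite gt_eqF.
have u2n0 : u + 2 != 0 by rewrite gt_eqF// addr_gt0.
have Dln : is_derive u 1 (@ln R) u^-1 by exact: is_derive1_ln.
have Dinv : is_derive u 1 (fun v : R => v^-1) (- u ^- 2 *: 1).
  exact: is_deriveV.
have Dinv2 : is_derive u 1 (fun v : R => (v + 2)^-1) (- (u + 2) ^- 2 *: (1 + 0)).
  exact: (is_deriveV (f := fun v : R => v + 2)).
apply: is_derive_eq.
rewrite /GRing.scale /=.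
by field; rewrite un0 u2n0.
Qed.

(** Multiplied by u, this is u ln u - u + 1 >= (3/2) (u - 1)^2 / (u + 2).  The
    difference vanishes at u = 1 and its derivative has the sign of u - 1. *)
Lemma ln_lower_bound (R : realType) (u : R) : 0 < u ->
  0 <= ln u + 4^-1 * u^-1 + 27 / 4 * (u + 2)^-1 - 5 / 2.
Proof.
set f := fun v : R => ln v + 4^-1 * v^-1 + 27 / 4 * (v + 2)^-1 - 5 / 2.
have f1 : f 1 = 0 by rewrite /f ln1; field.
have df (v : R) : 0 < v ->
    derivable f v 1 /\ derive1 f v = (v - 1) ^+ 3 / (v ^+ 2 * (v + 2) ^+ 2).
  move=> v0; have D := is_derive_pinsker v0.
  by split; [exact: ex_derive|rewrite derive1E; exact: derive_val].
have cf (a b : R) : 0 < a -> {within `[a, b], continuous f}.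
  move=> a0; apply: derivable_within_continuous => v.
  by rewrite in_itv/= => /andP[av _]; exact: (df _ (lt_le_trans a0 av)).1.
have den (v : R) : 0 < v -> 0 <= (v ^+ 2 * (v + 2) ^+ 2)^-1.
  by move=> v0; rewrite invr_ge0 mulr_ge0 ?sqr_ge0.
move=> u0; rewrite -[leRHS]/(f u) -f1; have [u1|u1] := leP u 1.
  apply: (@ler0_derive1_nincr _ f u 1) => // [v|v|]; last exact: cf.
    by rewrite in_itv/= => /andP[uv _]; exact: (df _ (lt_trans u0 uv)).1.
  rewrite in_itv/= => /andP[uv v1]; have v0 := lt_trans u0 uv.
  rewrite (df v v0).2 mulr_le0_ge0 ?den//.
  by rewrite exprS mulr_le0_ge0 ?sqr_ge0// subr_le0 ltW.
apply: (@ger0_derive1_ndecr _ f 1 u) => // [v|v||]; last 2 first.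
- exact: cf.
- exact: ltW.
- by rewrite in_itv/= => /andP[v1 _]; exact: (df _ (lt_trans ltr01 v1)).1.
rewrite in_itv/= => /andP[v1 vu]; have v0 := lt_trans ltr01 v1.
rewrite (df v v0).2 mulr_ge0 ?den//.
by rewrite exprn_ge0// subr_ge0 ltW.
Qed.

(** The term a ln (a/b) - a + b is at least (3/2) d^2 / (a + 2 b) with d = |a - b|.
    Replacing this quotient by its lower bound
    (3/2) (2 m d - m^2 (a + 2 b)), valid for every m, makes the inequality
    linear in d, a and b, so that it can be summed without Cauchy-Schwarz. *)
Lemma pinsker_pointwise (R : realType) (a b m : R) :
  0 <= a -> 0 <= b -> (b = 0 -> a = 0) ->
  3 * m * `|a - b| - 3 / 2 * m ^+ 2 * (a + 2 * b) <=
  a * (ln a - ln b) - a + b.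
Proof.
move=> a0 b0 ab.
have [b00|bn0] := eqVneq b 0.
  by rewrite b00 (ab b00) !subrr normr0; lra.
have {}b0 : 0 < b by rewrite lt_neqAle eq_sym bn0.
set d := `|a - b|.
have d2 : d ^+ 2 = (a - b) ^+ 2 by rewrite /d real_normK ?num_real.
have [a00|an0] := eqVneq a 0.
  have -> : d = b by rewrite /d a00 sub0r normrN gtr0_norm.
  have := mulr_ge0 (ltW b0) (sqr_ge0 (m - 2^-1)).
  by rewrite a00 mul0r; nra.
have {}a0 : 0 < a by rewrite lt_neqAle eq_sym an0.
have c0 : 0 < a + 2 * b by lra.
apply: (@le_trans _ _ (3 / 2 * (a - b) ^+ 2 / (a + 2 * b))).
  rewrite ler_pdivlMr// -d2.
  suff : 0 <= (d - m * (a + 2 * b)) ^+ 2 by nra.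
  exact: sqr_ge0.
rewrite -ln_div ?posrE//.
have /(ler_wpM2l (ltW a0)) := ln_lower_bound (divr_gt0 a0 b0).
rewrite mulr0 => H; rewrite -subr_ge0; apply: (le_trans H).
rewrite le_eqVlt; apply/orP; left; apply/eqP.
by field; rewrite !gt_eqF.
Qed.

(** Summing the pointwise bound gives 3 m D - (9/2) m^2, where D is the distance
    and the total of a + 2 b is 3; the best m is D / 3. *)
Lemma pinsker (R : realType) (T : finType) (a b : T -> R) :
  (forall z, 0 <= a z) -> (forall z, 0 <= b z) ->
  (forall z, b z = 0 -> a z = 0) ->
  \sum_z a z = 1 -> \sum_z b z = 1 ->
  (\sum_z `|a z - b z|) ^+ 2 <= 2 * \sum_z a z * (ln (a z) - ln (b z)).
Proof.
move=> a0 b0 ab a1 b1; set D := \sum_z `|_|.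
have : \sum_z (D * `|a z - b z| - 6^-1 * D ^+ 2 * (a z + 2 * b z)) <=
       \sum_z (a z * (ln (a z) - ln (b z)) - a z + b z).
  apply: ler_sum => z _; apply: le_trans (pinsker_pointwise (D / 3) _ _ (ab z)) => //.
  by rewrite le_eqVlt; apply/orP; left; apply/eqP; field.
rewrite big_split sumrN big_split big_split sumrN -!mulr_sumr big_split.
rewrite -mulr_sumr /= a1 b1 -/D.
set K := \sum_z a z * (ln (a z) - ln (b z)).
nra.
Qed.

(** Relative entropy with respect to the uniform law is nonnegative. *)
Lemma entropy_le_ln_card (R : realType) (X : finType) (p : X -> R) :
  simplex R X p -> entropy p <= ln (#|X|%:R).
Proof.
move=> [p0 p1].
have X0 : 0 < #|X|%:R :> R.
  rewrite ltr0n; apply/card_gt0P; apply: contrapT => nX.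
  move: p1; rewrite big_pred0 => [/eqP|x]; first by rewrite eq_sym oner_eq0.
  by exfalso; apply: nX; exists x.
set b := #|X|%:R^-1 : R; have b0 : 0 < b by rewrite invr_gt0.
have sb : \sum_(x : X) b = 1 by rewrite sumr_const -mulr_natl mulfV ?gt_eqF.
have : \sum_x (p x - b) <= \sum_x p x * (ln (p x) - ln b).
  apply: ler_sum => x _.
  have bn0 : b = 0 -> p x = 0 by move=> b00; move: b0; rewrite b00 ltxx.
  have := pinsker_pointwise 0 (p0 x) (ltW b0) bn0.
  by rewrite expr0n mulr0 !mul0r mulr0 mul0r subrr; lra.
rewrite sumrB p1 sb subrr.
under eq_bigr do rewrite mulrBr.
rewrite sumrB -mulr_suml p1 mul1r lnV ?posrE// opprK.
rewrite /entropy. lra.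
Qed.

(** * The minimax theorem for matrix games *)

Lemma simplex_dirac (R : realType) (T : finType) (z : T) :
  simplex R T (fun x => (x == z)%:R).
Proof.
by split=> [x|]; [exact: ler0n|rewrite (bigD1 z)//= eqxx big1 ?addr0// => x /negPf->].
Qed.

Lemma simplex_mean_le (R : realType) (T : finType) (a f : T -> R) (M : R) :
  simplex R T a -> (forall x, f x <= M) -> \sum_x a x * f x <= M.
Proof.
move=> [a0 a1] fM; rewrite -[leRHS]mul1r -a1 mulr_suml.
by apply: ler_sum => x _; rewrite ler_wpM2l.
Qed.

Lemma simplex_mean_norm (R : realType) (T : finType) (a f : T -> R) (M : R) :
  simplex R T a -> (forall x, `|f x| <= M) -> `|\sum_x a x * f x| <= M.
Proof.
move=> sa fM; apply: le_trans (simplex_mean_le sa fM).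
apply: le_trans (ler_norm_sum _ _ _) _.
by apply: ler_sum => x _; rewrite normrM (ger0_norm (sa.1 x)).
Qed.

Lemma mixed_payoff_rows (R : realType) (I J : finType) (A : I -> J -> R) a b :
  mixed_payoff A a b = \sum_i a i * \sum_j b j * A i j.
Proof.
apply: eq_bigr => i _; rewrite mulr_sumr; apply: eq_bigr => j _.
by rewrite mulrA mulrAC.
Qed.

Lemma mixed_payoff_cols (R : realType) (I J : finType) (A : I -> J -> R) a b :
  mixed_payoff A a b = \sum_j b j * \sum_i a i * A i j.
Proof.
rewrite /mixed_payoff exchange_big; apply: eq_bigr => j _; rewrite mulr_sumr.
by apply: eq_bigr => i _; rewrite mulrC.
Qed.

Lemma mixed_payoff_norm (R : realType) (I J : finType) (A : I -> J -> R) K a b :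
  (forall i j, `|A i j| <= K) -> simplex R I a -> simplex R J b ->
  `|mixed_payoff A a b| <= K.
Proof.
move=> AK sa sb; rewrite mixed_payoff_rows; apply: simplex_mean_norm => // i.
exact: simplex_mean_norm.
Qed.

Lemma matrix_bounded (R : realType) (I J : finType) (A : I -> J -> R) :
  exists K, forall i j, `|A i j| <= K.
Proof.
exists (\sum_i \sum_j `|A i j|) => i j.
rewrite (bigD1 i)//= (bigD1 j)//= -addrA lerDl addr_ge0// sumr_ge0// => ? _.
by rewrite sumr_ge0.
Qed.

Lemma minmax_has_inf (R : realType) (I J : finType) (A : I -> J -> R) :
  (0 < #|I|)%N -> (0 < #|J|)%N ->
  has_inf [set sup [set mixed_payoff A a b | a in simplex R I] |
            b in simplex R J].
Proof.
move=> /card_gt0P[i0 _] /card_gt0P[j0 _]; have [K AK] := matrix_bounded A.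
split; first by eexists; exists (fun j => (j == j0)%:R) => //; exact: simplex_dirac.
exists (- K) => _ [b sb <-].
have si0 := simplex_dirac R i0.
apply: (@le_trans _ _ (mixed_payoff A (fun i => (i == i0)%:R) b)).
  by have := mixed_payoff_norm AK si0 sb; rewrite ler_norml => /andP[].
apply: ub_le_sup; last by eexists; [exact: si0|].
exists K => _ [a sa <-]; have := mixed_payoff_norm AK sa sb.
by rewrite ler_norml => /andP[].
Qed.

Lemma minmax_le (R : realType) (I J : finType) (A : I -> J -> R) b M :
  (0 < #|I|)%N -> simplex R J b -> (forall i, \sum_j b j * A i j <= M) ->
  minmax_value A <= M.
Proof.
move=> I0 sb bM.
have J0 : (0 < #|J|)%N.
  rewrite lt0n; apply/negP => /eqP/card0_eq J0; have := sb.2.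
  by rewrite big_pred0 => [/eqP|j]; [rewrite eq_sym oner_eq0|have := J0 j].
have [_ lb] := minmax_has_inf A I0 J0.
apply: le_trans (ge_inf lb _) _; first by exists b.
apply: ge_sup.
  case/card_gt0P : I0 => i0 _; eexists; exists (fun i => (i == i0)%:R) => //.
  exact: simplex_dirac.
by move=> _ [a sa <-]; rewrite mixed_payoff_rows; exact: simplex_mean_le.
Qed.

Lemma minmax_approx (R : realType) (I J : finType) (A : I -> J -> R) (e : R) :
  (0 < #|I|)%N -> (0 < #|J|)%N -> 0 < e ->
  exists2 b, simplex R J b &
    forall a, simplex R I a -> mixed_payoff A a b <= minmax_value A + e.
Proof.
move=> I0 J0 e0; have [_ [b sb <-] Hb] := inf_adherent e0 (minmax_has_inf A I0 J0).
exists b => // a sa; apply: le_trans (ltW Hb); apply: ub_le_sup; last by exists a.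
have [K AK] := matrix_bounded A; exists K => _ [a' sa' <-].
by have := mixed_payoff_norm AK sa' sb; rewrite ler_norml => /andP[].
Qed.

(** Approachability of the nonpositive orthant.  The function c counts how often
    each action of the column player was chosen.  He answers the mixed action
    proportional to the positive part g of the accumulated payoff vector by an
    action whose payoff vector has a nonpositive inner product with g.  Then the
    square of g increases at each step by at most the square of one payoff
    vector, hence linearly in T. *)
Lemma approachability (R : realType) (I J : finType) (B : I -> J -> R) (j0 : J) :
  (forall a, simplex R I a -> exists j, \sum_i a i * B i j <= 0) ->
  forall T : nat, exists c : J -> R,
    [/\ forall j, 0 <= c j, \sum_j c j = T%:R &
      \sum_i (Num.max 0 (\sum_j c j * B i j)) ^+ 2 <=
        T%:R * \sum_i \sum_j B i j ^+ 2].
Proof.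
move=> HB; elim=> [|T [c [c0 cT cB]]].
  exists (fun=> 0); split=> //; first by rewrite big1.
  rewrite mul0r big1// => i _; rewrite big1 ?maxxx ?expr0n// => j _.
  by rewrite mul0r.
pose g i := Num.max 0 (\sum_j c j * B i j).
have g0 i : 0 <= g i by rewrite le_max lexx.
have [j Hj] : exists j, \sum_i g i * B i j <= 0.
  have [S0|S0] := eqVneq (\sum_i g i) 0.
    exists j0; rewrite big1// => i _.
    have /eqP := S0; rewrite psumr_eq0// => /allP/(_ i (mem_index_enum i))/eqP->.
    by rewrite mul0r.
  have {}S0 : 0 < \sum_i g i by rewrite lt_neqAle eq_sym S0 sumr_ge0.
  have [|j Hj] := HB (fun i => g i / \sum_i g i).
    split=> [i|]; first by rewrite divr_ge0// ltW.
    by rewrite -mulr_suml divff ?gt_eqF.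
  exists j; move: Hj; under eq_bigr do rewrite mulrAC.
  by rewrite -mulr_suml pmulr_lle0 ?invr_gt0.
exists (fun k => c k + (k == j)%:R); split=> [k||].
- by rewrite addr_ge0.
- by rewrite big_split/= cT (simplex_dirac R j).2 -natr1.
have -> : T.+1%:R * \sum_i \sum_j B i j ^+ 2 =
    T%:R * (\sum_i \sum_j B i j ^+ 2) + \sum_i \sum_j B i j ^+ 2.
  by rewrite -natr1 mulrDl mul1r.
apply: (@le_trans _ _ (\sum_i (g i ^+ 2 + 2 * (g i * B i j) + B i j ^+ 2))).
  apply: ler_sum => i _.
  have -> : \sum_k (c k + (k == j)%:R) * B i k = \sum_k c k * B i k + B i j.
    under eq_bigr do rewrite mulrDl.
    rewrite big_split/=; congr (_ + _).
    rewrite (bigD1 j)//= eqxx mul1r big1 ?addr0//.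
    by move=> k /negPf->; rewrite mul0r.
  have : \sum_k c k * B i k <= g i by rewrite le_max lexx orbT.
  move: (\sum_k c k * B i k) (g0 i) => x gi0 xg.
  have -> : g i ^+ 2 + 2 * (g i * B i j) + B i j ^+ 2 = (g i + B i j) ^+ 2.
    by ring.
  case: (leP 0 (x + B i j)) => h; last by rewrite expr0n sqr_ge0.
  by rewrite ler_pXn2r ?nnegrE ?lerD2r// (le_trans h)// lerD2r.
rewrite !big_split /= -mulr_sumr lerD//.
  have : 2 * \sum_i g i * B i j <= 0 by rewrite pmulr_rle0.
  by move: cB; rewrite -/g /=; lra.
apply: ler_sum => i _; rewrite [leRHS](bigD1 j)//= lerDl sumr_ge0// => k _.
exact: sqr_ge0.
Qed.

(** Otherwise every mixed action has a reply that holds it to at most v, and the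
    frequencies of replies given by approachability hold every row to v plus a
    term of order 1 / sqrt T, which contradicts the choice of v. *)
Lemma minimax_mixed_action (R : realType) (I J : finType) (A : I -> J -> R) (v : R) :
  (0 < #|I|)%N -> (0 < #|J|)%N -> v < minmax_value A ->
  exists2 a, simplex R I a & forall j, v <= \sum_i a i * A i j.
Proof.
move=> I0 J0 vA; case/card_gt0P : (J0) => j0 _.
apply: contrapT => nA.
pose B i j := A i j - v.
have HB a : simplex R I a -> exists j, \sum_i a i * B i j <= 0.
  move=> sa; apply: contrapT => nj; apply: nA; exists a => // j.
  rewrite leNgt; apply/negP => Hj; apply: nj; exists j.
  rewrite /B; under eq_bigr do rewrite mulrBr.
  by rewrite sumrB -mulr_suml sa.2 mul1r subr_le0 ltW.
set C := \sum_i \sum_j B i j ^+ 2.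
(* Any bound strictly between v and the minmax value gives the contradiction. *)
pose e := (minmax_value A - v) / 2.
have e0 : 0 < e by rewrite divr_gt0// subr_gt0.
have e2 : 0 < e ^+ 2 by rewrite exprn_gt0.
have [T HT] : exists T : nat, C / e ^+ 2 < T.+1%:R.
  exists (Num.bound (C / e ^+ 2)); apply: lt_le_trans (archi_boundP _) _.
    rewrite divr_ge0 ?sqr_ge0// sumr_ge0// => i _; rewrite sumr_ge0// => j _.
    exact: sqr_ge0.
  by rewrite ler_nat.
have T0 : 0 < T.+1%:R :> R by rewrite ltr0n.
have [c [c0 cT cB]] := approachability j0 HB T.+1.
have : minmax_value A <= v + e; last by rewrite /e; lra.
apply: (@minmax_le _ _ _ _ (fun j => c j / T.+1%:R)) => // [|i].
  split=> [j|]; first by rewrite divr_ge0// ltW.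
  by rewrite -mulr_suml cT divff ?gt_eqF.
have -> : \sum_j c j / T.+1%:R * A i j = v + (\sum_j c j * B i j) / T.+1%:R.
  under [in RHS]eq_bigr do rewrite /B mulrBr.
  rewrite sumrB -mulr_suml cT mulrBl mulrAC divff ?gt_eqF// mul1r addrC subrK.
  by rewrite mulr_suml; apply: eq_bigr => j _; rewrite mulrAC.
rewrite lerD2l ler_pdivrMr// leNgt; apply/negP => eT.
have eT0 : 0 < e * T.+1%:R by rewrite mulr_gt0.
have : (e * T.+1%:R) ^+ 2 < T.+1%:R * C.
  apply: lt_le_trans cB.
  rewrite (bigD1 i)//= max_r; last exact: ltW (lt_trans eT0 eT).
  apply: (@lt_le_trans _ _ ((\sum_j c j * B i j) ^+ 2)).
    by rewrite ltr_pXn2r// nnegrE ltW// (lt_trans eT0 eT).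
  by rewrite lerDl sumr_ge0// => k _; exact: sqr_ge0.
move: HT; rewrite ltr_pdivrMr// => HT.
by rewrite exprMn expr2 mulrA [_ * T.+1%:R]mulrC ltr_pM2l// ltNge mulrC ltW.
Qed.

(** * Concave functions on the simplex *)

Lemma simplex_convex (R : realType) (X : finType) (q r : X -> R) (c : R) :
  simplex R X q -> simplex R X r -> 0 <= c <= 1 ->
  simplex R X (fun x => c * q x + (1 - c) * r x).
Proof.
move=> [q0 q1] [r0 r1] /andP[c0 c1]; split=> [x|].
  by rewrite addr_ge0// mulr_ge0// subr_ge0.
by rewrite big_split/= -!mulr_sumr q1 r1; lra.
Qed.

(** The induction absorbs the points of the sequence one after the other into the
    extra point q0 of weight c0. *)
Lemma concave_jensen_seq (R : realType) (X : finType) (f : (X -> R) -> R)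
    (T : Type) (r : seq T) (c : T -> R) (q : T -> X -> R) c0 q0 :
  concave_on_simplex f -> (forall z, 0 <= c z) ->
  (forall z, simplex R X (q z)) -> 0 <= c0 -> simplex R X q0 ->
  c0 + \sum_(z <- r) c z = 1 ->
  c0 * f q0 + \sum_(z <- r) c z * f (q z) <=
  f (fun x => c0 * q0 x + \sum_(z <- r) c z * q z x).
Proof.
move=> cf cge sq; elim: r c0 q0 => [|z r IH] c0 q0 c00 sq0.
  rewrite !big_nil !addr0 => ->; rewrite mul1r le_eqVlt; apply/orP; left.
  by apply/eqP; congr f; apply/funext => x; rewrite big_nil addr0 mul1r.
rewrite !big_cons !addrA => C1.
have [S0|S0] := eqVneq (c0 + c z) 0.
  have [z0 cz0] : c0 = 0 /\ c z = 0 by have := cge z; split; lra.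
  move: C1; rewrite z0 cz0 !mul0r add0r => C1.
  have := IH 0 q0 (lexx _) sq0 C1; rewrite mul0r => /le_trans; apply.
  rewrite le_eqVlt; apply/orP; left; apply/eqP; congr f; apply/funext => x.
  by rewrite big_cons cz0 !mul0r !add0r.
have {}S0 : 0 < c0 + c z by rewrite lt_neqAle eq_sym S0 addr_ge0.
set l := c0 / (c0 + c z).
have l01 : 0 <= l <= 1.
  by rewrite divr_ge0 ?(ltW S0)// ler_pdivrMr// mul1r lerDl cge.
have lE : (c0 + c z) * l = c0 by rewrite /l mulrC divfK ?gt_eqF.
have mE a b : (c0 + c z) * (l * a + (1 - l) * b) = c0 * a + c z * b.
  transitivity ((c0 + c z) * l * (a - b) + (c0 + c z) * b); first by ring.
  by rewrite lE; ring.
have := IH _ _ (ltW S0) (simplex_convex sq0 (sq z) l01) C1.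
have /(ler_wpM2l (ltW S0)) := cf _ _ _ sq0 (sq z) l01.
rewrite mE => H1 H2.
apply: (@le_trans _ _ ((c0 + c z) * f (fun x => l * q0 x + (1 - l) * q z x) +
    \sum_(y <- r) c y * f (q y))); first by rewrite lerD2r.
apply: (le_trans H2).
rewrite le_eqVlt; apply/orP; left; apply/eqP; congr f; apply/funext => x.
by rewrite big_cons mE addrA.
Qed.

Lemma concave_jensen (R : realType) (X T : finType) (f : (X -> R) -> R)
    (c : T -> R) (q : T -> X -> R) :
  concave_on_simplex f -> simplex R T c -> (forall z, simplex R X (q z)) ->
  \sum_z c z * f (q z) <= f (fun x => \sum_z c z * q z x).
Proof.
move=> cf [c0 c1] sq; set m : X -> R := fun x => _.
have sm : simplex R X m.
  split=> [x|]; first by rewrite sumr_ge0// => z _; rewrite mulr_ge0// (sq z).1.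
  rewrite exchange_big -c1; apply: eq_bigr => z _.
  by rewrite -mulr_sumr (sq z).2 mulr1.
have := concave_jensen_seq (r := index_enum T) cf c0 sq (lexx 0) sm.
rewrite add0r mul0r add0r => /(_ c1) /le_trans; apply.
rewrite le_eqVlt; apply/orP; left; apply/eqP; congr f; apply/funext => x.
by rewrite mul0r add0r.
Qed.

(** * Plays and stage payoffs *)

Lemma rcons_tuple_bij (T : finType) (n : nat) :
  bijective (fun z : n.-tuple T * T => rcons_tuple z.1 z.2).
Proof.
apply: inj_card_bij; last by rewrite card_prod !card_tuple expnSr.
move=> [h a] [h' a'] /(congr1 val)/= /rcons_inj[hh ->].
by congr (_, _); exact: val_inj.
Qed.

Lemma big_tuple_rcons (R : realType) (T : finType) (n : nat)
    (F : n.+1.-tuple T -> R) :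
  \sum_h F h = \sum_(h : n.-tuple T) \sum_a F (rcons_tuple h a).
Proof.
rewrite pair_bigA /=; apply: reindex.
exact: onW_bij (rcons_tuple_bij T n).
Qed.

Lemma tuple_rcons_ind (T : finType) (P : forall n, n.-tuple T -> Prop) :
  P 0%N [tuple] -> (forall n (h : n.-tuple T) a, P n h -> P n.+1 (rcons_tuple h a)) ->
  forall n h, P n h.
Proof.
move=> P0 PS; elim=> [|n IH] h; first by rewrite tuple0.
have [g _ gK] := rcons_tuple_bij T n.
by rewrite -(gK h); exact: PS.
Qed.

Lemma play_prob0 (R : realType) (X I J : finType) (p : X -> R) s
    (t : seq (I * J) -> J -> R) x (h : 0.-tuple (I * J)) :
  play_prob p s t x h = p x.
Proof. by rewrite /play_prob big_ord0 mulr1. Qed.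

Lemma play_prob_rcons (R : realType) (X I J : finType) (p : X -> R) s
    (t : seq (I * J) -> J -> R) x n (h : n.-tuple (I * J)) a :
  play_prob p s t x (rcons_tuple h a) =
  play_prob p s t x h * (s x h a.1 * t h a.2).
Proof.
rewrite /play_prob big_ord_recr/= -mulrA; congr (_ * (_ * _)).
  apply: eq_bigr => i _; have ih : (i < size h)%N by rewrite size_tuple.
  rewrite !(tnth_nth a) /= nth_rcons ih -cats1 takel_cat//.
  by rewrite size_tuple ltnW.
rewrite !(tnth_nth a) /= nth_rcons size_tuple ltnn eqxx.
by rewrite -cats1 take_size_cat ?size_tuple.
Qed.

Lemma play_prob_in_tuple (R : realType) (X I J : finType) (p : X -> R) s
    (t : seq (I * J) -> J -> R) x n (h : n.-tuple (I * J)) :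
  play_prob p s t x (in_tuple h) = play_prob p s t x h.
Proof.
case: h => h hn; have E := eqP hn; subst n.
by congr play_prob; exact: val_inj.
Qed.

(** The contribution of nature and P1 to the probability of the play (x, h): the
    weight 1 replaces the choices of P2. *)
Definition reach_prob (R : realType) (X I J : finType) (p : X -> R)
    (s : X -> seq (I * J) -> I -> R) (x : X) (h : seq (I * J)) : R :=
  play_prob p s (fun _ _ => 1) x (in_tuple h).

Lemma reach_prob0 (R : realType) (X I J : finType) (p : X -> R)
    (s : X -> seq (I * J) -> I -> R) (x : X) (h : 0.-tuple (I * J)) :
  reach_prob p s x h = p x.
Proof. by rewrite /reach_prob play_prob_in_tuple play_prob0. Qed.

Lemma reach_prob_rcons (R : realType) (X I J : finType) (p : X -> R)
    (s : X -> seq (I * J) -> I -> R) (x : X) n (h : n.-tuple (I * J)) a :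
  reach_prob p s x (rcons_tuple h a) = reach_prob p s x h * s x h a.1.
Proof. by rewrite /reach_prob !play_prob_in_tuple play_prob_rcons mulr1. Qed.

Lemma play_prob_ge0 (R : realType) (X I J : finType) (p : X -> R) s
    (t : seq (I * J) -> J -> R) x n (h : n.-tuple (I * J)) :
  (forall x, 0 <= p x) -> (forall x h i, 0 <= s x h i) ->
  (forall h j, 0 <= t h j) -> 0 <= play_prob p s t x h.
Proof.
by move=> p0 s0 t0; rewrite mulr_ge0// prodr_ge0// => i _; rewrite mulr_ge0.
Qed.

Lemma play_probE (R : realType) (X I J : finType) (p : X -> R) s
    (t : seq (I * J) -> J -> R) x n (h : n.-tuple (I * J)) :
  play_prob p s t x h =
  reach_prob p s x h * \prod_(m < n) t (take m h) (tnth h m).2.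
Proof.
rewrite /reach_prob play_prob_in_tuple /play_prob -mulrA -big_split/=.
by congr (_ * _); apply: eq_bigr => i _; rewrite mulr1.
Qed.

Lemma sum_action_pairs (R : realType) (I J : finType) (F : I * J -> R) :
  \sum_a F a = \sum_i \sum_j F (i, j).
Proof. by rewrite pair_bigA; apply: eq_bigr => -[]. Qed.

Lemma sum_play_prob_rcons (R : realType) (X I J : finType) (p : X -> R) s t x n
    (h : n.-tuple (I * J)) :
  strategies1 R X I J s -> strategies2 R I J t ->
  \sum_a play_prob p s t x (rcons_tuple h a) = play_prob p s t x h.
Proof.
move=> ss st; under eq_bigr do rewrite play_prob_rcons.
rewrite -mulr_sumr sum_action_pairs/= -[RHS]mulr1; congr (_ * _).
rewrite -(ss x h).2; apply: eq_bigr => i _.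
by rewrite -mulr_sumr (st h).2 mulr1.
Qed.

Lemma sum_play_prob (R : realType) (X I J : finType) (p : X -> R) s t x n :
  strategies1 R X I J s -> strategies2 R I J t ->
  \sum_(h : n.-tuple (I * J)) play_prob p s t x h = p x.
Proof.
move=> ss st; elim: n => [|n IH].
  rewrite (bigD1 [tuple])//= play_prob0 big1 ?addr0// => h /eqP[].
  exact: tuple0.
rewrite big_tuple_rcons -IH; apply: eq_bigr => h _.
exact: sum_play_prob_rcons.
Qed.

(** The expected payoff of the stage numbered n: h is the history before it and
    a is the action pair played. *)
Definition stage_payoff (R : realType) (X I J : finType) (G : X -> I -> J -> R)
    (p : X -> R) s t n : R :=
  \sum_(h : n.-tuple (I * J)) \sum_a \sum_x
    play_prob p s t x (rcons_tuple h a) * G x a.1 a.2.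

Lemma expected_payoffE (R : realType) (X I J : finType)
    (G : X -> I -> J -> R) (p : X -> R) k s t :
  strategies1 R X I J s -> strategies2 R I J t ->
  expected_payoff G p k s t = k%:R^-1 * \sum_(n < k) stage_payoff G p s t n.
Proof.
move=> ss st; pose S k (h : k.-tuple (I * J)) x :=
  \sum_(n < k) G x (tnth h n).1 (tnth h n).2.
have -> : expected_payoff G p k s t = k%:R^-1 *
    \sum_x \sum_(h : k.-tuple (I * J)) play_prob p s t x h * S k h x.
  rewrite mulr_sumr; apply: eq_bigr => x _; rewrite mulr_sumr.
  by apply: eq_bigr => h _; rewrite mulrCA.
congr (_ * _); elim: k => [|k IH].
  rewrite big_ord0 big1// => x _; rewrite big1// => h _.
  by rewrite /S big_ord0 mulr0.
rewrite big_ord_recr/= -IH.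
have SE h a x : S k.+1 (rcons_tuple h a) x = S k h x + G x a.1 a.2.
  rewrite /S big_ord_recr/=; congr (_ + _); last first.
    by rewrite !(tnth_nth a)/= nth_rcons size_tuple ltnn eqxx.
  apply: eq_bigr => n _; rewrite !(tnth_nth a)/= nth_rcons size_tuple.
  by rewrite ltn_ord.
rewrite /stage_payoff; under [X in _ = _ + X]eq_bigr do rewrite exchange_big/=.
rewrite [X in _ = _ + X]exchange_big -big_split/=; apply: eq_bigr => x _.
rewrite big_tuple_rcons -big_split/=; apply: eq_bigr => h _.
under eq_bigr do rewrite SE mulrDr.
by rewrite big_split/= -mulr_suml sum_play_prob_rcons.
Qed.

Lemma payoff_norm_ge0 (R : realType) (X I J : finType) (G : X -> I -> J -> R) :
  0 <= payoff_norm G.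
Proof. exact: bigmax_ge_id. Qed.

Lemma payoff_le_norm (R : realType) (X I J : finType) (G : X -> I -> J -> R)
  x i j : `|G x i j| <= payoff_norm G.
Proof.
rewrite /payoff_norm; do 3 (apply: le_trans (le_bigmax_cond _ _ _) => //=).
Qed.

Lemma expected_payoff_norm (R : realType) (X I J : finType)
    (G : X -> I -> J -> R) (p : X -> R) k s t :
  simplex R X p -> strategies1 R X I J s -> strategies2 R I J t ->
  `|expected_payoff G p k s t| <= payoff_norm G.
Proof.
move=> sp ss st.
have pp x (h : k.-tuple (I * J)) : 0 <= play_prob p s t x h.
  by apply: play_prob_ge0 => [y|y g|g]; [exact: sp.1|exact: (ss y g).1|exact: (st g).1].
rewrite -[leRHS]mul1r -sp.2 mulr_suml.
apply: le_trans (ler_norm_sum _ _ _) _; apply: ler_sum => x _.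
apply: le_trans (ler_norm_sum _ _ _) _.
rewrite -(sum_play_prob p x k ss st) mulr_suml; apply: ler_sum => h _.
rewrite normrM ger0_norm// ler_wpM2l//.
case: k {pp} h => [|k] h; first by rewrite /mean_payoff invr0 mul0r normr0 payoff_norm_ge0.
rewrite normrM ger0_norm ?invr_ge0// mulrC ler_pdivrMr ?ltr0n//.
apply: le_trans (ler_norm_sum _ _ _) _.
apply: le_trans (ler_sum _ (fun n _ => payoff_le_norm G x _ _)) _.
by rewrite sumr_const card_ord mulr_natr.
Qed.

(** * Guarantees and the value *)

Lemma strategies1_nonempty (R : realType) (X I J : finType) :
  (0 < #|I|)%N -> strategies1 R X I J !=set0.
Proof.
move=> /card_gt0P[i0 _]; exists (fun _ _ i => (i == i0)%:R) => x h.
exact: simplex_dirac.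
Qed.

Lemma strategies2_nonempty (R : realType) (I J : finType) :
  (0 < #|J|)%N -> strategies2 R I J !=set0.
Proof.
by move=> /card_gt0P[j0 _]; exists (fun _ j => (j == j0)%:R) => h; exact: simplex_dirac.
Qed.

Lemma guarantee_has_inf (R : realType) (X I J : finType)
    (G : X -> I -> J -> R) k p s :
  (0 < #|J|)%N -> simplex R X p -> strategies1 R X I J s ->
  has_inf [set expected_payoff G p k s t | t in strategies2 R I J].
Proof.
move=> J0 sp ss; split.
  by have [t st] := strategies2_nonempty R I J0; eexists; exists t.
exists (- payoff_norm G) => _ [t st <-].
by have := expected_payoff_norm G k sp ss st; rewrite ler_norml => /andP[].
Qed.

Lemma game_value_has_sup (R : realType) (X I J : finType)
    (G : X -> I -> J -> R) k p :
  (0 < #|I|)%N -> (0 < #|J|)%N -> simplex R X p ->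
  has_sup [set inf [set expected_payoff G p k s t | t in strategies2 R I J] |
            s in strategies1 R X I J].
Proof.
move=> I0 J0 sp; split.
  by have [s ss] := strategies1_nonempty R X J I0; eexists; exists s.
exists (payoff_norm G) => _ [s ss <-].
have [t st] := strategies2_nonempty R I J0.
have [_ lb] := guarantee_has_inf G k J0 sp ss.
apply: le_trans (ge_inf lb _) _; first by exists t.
by have := expected_payoff_norm G k sp ss st; rewrite ler_norml => /andP[].
Qed.

Lemma game_value_ge (R : realType) (X I J : finType)
    (G : X -> I -> J -> R) k p s v :
  (0 < #|I|)%N -> (0 < #|J|)%N -> simplex R X p -> strategies1 R X I J s ->
  (forall t, strategies2 R I J t -> v <= expected_payoff G p k s t) ->
  v <= game_value G k p.
Proof.
move=> I0 J0 sp ss Hv.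
have [_ ub] := game_value_has_sup G k I0 J0 sp.
apply: le_trans (ub_le_sup ub _); last by exists s.
apply: lb_le_inf; first exact: (guarantee_has_inf G k J0 sp ss).1.
by move=> _ [t st <-]; exact: Hv.
Qed.

Lemma game_value_le (R : realType) (X I J : finType)
    (G : X -> I -> J -> R) k p v :
  (0 < #|I|)%N -> (0 < #|J|)%N -> simplex R X p ->
  (forall s, strategies1 R X I J s ->
    exists2 t, strategies2 R I J t & expected_payoff G p k s t <= v) ->
  game_value G k p <= v.
Proof.
move=> I0 J0 sp Hv; apply: ge_sup; first exact: (game_value_has_sup G k I0 J0 sp).1.
move=> _ [s ss <-]; have [t st] := Hv s ss; apply: le_trans.
by apply: ge_inf; [exact: (guarantee_has_inf G k J0 sp ss).2|exists t].
Qed.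

Lemma game_value_approx (R : realType) (X I J : finType)
    (G : X -> I -> J -> R) k p e :
  (0 < #|I|)%N -> (0 < #|J|)%N -> simplex R X p -> 0 < e ->
  exists2 s, strategies1 R X I J s &
    forall t, strategies2 R I J t ->
      game_value G k p - e <= expected_payoff G p k s t.
Proof.
move=> I0 J0 sp e0.
have [_ [s ss <-] Hs] := sup_adherent e0 (game_value_has_sup G k I0 J0 sp).
exists s => // t st; apply: le_trans (ltW Hs) _.
by apply: ge_inf; [exact: (guarantee_has_inf G k J0 sp ss).2|exists t].
Qed.

(** P1 plays the same nearly optimal mixed action after every history and in every
    state, so that P2 never learns anything. *)
Lemma nonrevealing_le_game_value (R : realType) (X I J : finType)
    (G : X -> I -> J -> R) k p :
  (0 < #|I|)%N -> (0 < #|J|)%N -> (0 < k)%N -> simplex R X p ->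
  nonrevealing_value G p <= game_value G k p.
Proof.
move=> I0 J0 k0 sp; apply/ler_addgt0Pr => e e0; rewrite -lerBlDr.
have [|a sa Ha] := @minimax_mixed_action _ _ _ (fun i j => \sum_x p x * G x i j)
  (nonrevealing_value G p - e) I0 J0; first by rewrite ltrBlDr ltrDl.
set v := nonrevealing_value G p - e in Ha *.
pose s (_ : X) (_ : seq (I * J)) := a.
have ss : strategies1 R X I J s by move=> x h.
apply: (game_value_ge I0 J0 sp ss) => t st.
rewrite expected_payoffE// mulrC ler_pdivlMr ?ltr0n// mulr_natr.
have -> : v *+ k = \sum_(n < k) v by rewrite sumr_const card_ord.
apply: ler_sum => n _; rewrite /stage_payoff.
pose w (h : n.-tuple (I * J)) : R :=
  \prod_(m < n) (a (tnth h m).1 * t (take m h) (tnth h m).2).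
(* As s ignores the state, the play has probability p x * w h. *)
have wE x h : play_prob p s t x h = p x * w h by [].
have w0 h : 0 <= w h.
  by apply: prodr_ge0 => m _; rewrite mulr_ge0 ?sa.1// (st _).1.
have w1 : \sum_h w h = 1.
  transitivity (\sum_x \sum_(h : n.-tuple (I * J)) play_prob p s t x h).
    rewrite exchange_big; apply: eq_bigr => h _.
    by under eq_bigr do rewrite wE; rewrite -mulr_suml sp.2 mul1r.
  by rewrite -sp.2; apply: eq_bigr => x _; exact: sum_play_prob.
rewrite -[leLHS]mul1r -w1 mulr_suml; apply: ler_sum => h _.
have -> : \sum_b \sum_x play_prob p s t x (rcons_tuple h b) * G x b.1 b.2 =
    w h * mixed_payoff (fun i j => \sum_x p x * G x i j) a (t h).
  rewrite mulr_sumr sum_action_pairs; apply: eq_bigr => i _.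
  rewrite mulr_sumr; apply: eq_bigr => j _.
  rewrite mulr_sumr mulr_suml mulr_sumr; apply: eq_bigr => x _.
  by rewrite play_prob_rcons wE /s /=; ring.
rewrite ler_wpM2l// mixed_payoff_cols -[leLHS]mul1r -(st h).2 mulr_suml.
by apply: ler_sum => j _; rewrite ler_wpM2l// (st h).1.
Qed.

(** The behavioral form of the following mixed strategy for the prior
    c q + (1 - c) r: choose sq or sr with the conditional probabilities, given
    the state, of the lottery with weights c and 1 - c between the priors q and
    r.  After the history h the action follows the
    conditional law of the strategy chosen, given x and h. *)
Definition splitting_strategy (R : realType) (X I J : finType) (c : R)
    (q : X -> R) (sq : X -> seq (I * J) -> I -> R)
    (r : X -> R) (sr : X -> seq (I * J) -> I -> R) :
    X -> seq (I * J) -> I -> R :=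
  fun x h i =>
    let D := c * reach_prob q sq x h + (1 - c) * reach_prob r sr x h in
    if D == 0 then sq x h i
    else (c * reach_prob q sq x h * sq x h i +
          (1 - c) * reach_prob r sr x h * sr x h i) / D.

Lemma reach_prob_ge0 (R : realType) (X I J : finType) (p : X -> R) s x
    (h : seq (I * J)) :
  simplex R X p -> strategies1 R X I J s -> 0 <= reach_prob p s x h.
Proof.
move=> sp ss; apply: play_prob_ge0 => // [y|y g i]; first exact: sp.1.
exact: (ss y g).1.
Qed.

Lemma splitting_strategyP (R : realType) (X I J : finType) (c : R)
    (q : X -> R) (sq : X -> seq (I * J) -> I -> R)
    (r : X -> R) (sr : X -> seq (I * J) -> I -> R) :
  0 <= c <= 1 -> simplex R X q -> simplex R X r ->
  strategies1 R X I J sq -> strategies1 R X I J sr ->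
  strategies1 R X I J (splitting_strategy c q sq r sr).
Proof.
move=> /andP[c0 c1] sq' sr' ssq ssr x h; rewrite /splitting_strategy.
set D := _ + _; have [_|Dn0] := eqVneq D 0; first exact: ssq.
have q0 : 0 <= c * reach_prob q sq x h by rewrite mulr_ge0// reach_prob_ge0.
have r0 : 0 <= (1 - c) * reach_prob r sr x h.
  by rewrite mulr_ge0 ?subr_ge0// reach_prob_ge0.
split=> [i|].
  rewrite divr_ge0 ?addr_ge0//; rewrite mulr_ge0//.
    exact: (ssq x h).1.
  exact: (ssr x h).1.
rewrite -mulr_suml big_split/= -!mulr_sumr (ssq x h).2 (ssr x h).2 !mulr1.
exact: divff.
Qed.

Lemma reach_prob_splitting (R : realType) (X I J : finType) (c : R)
    (q : X -> R) (sq : X -> seq (I * J) -> I -> R)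
    (r : X -> R) (sr : X -> seq (I * J) -> I -> R) x n (h : n.-tuple (I * J)) :
  0 <= c <= 1 -> simplex R X q -> simplex R X r ->
  strategies1 R X I J sq -> strategies1 R X I J sr ->
  reach_prob (fun x => c * q x + (1 - c) * r x)
    (splitting_strategy c q sq r sr) x h =
  c * reach_prob q sq x h + (1 - c) * reach_prob r sr x h.
Proof.
move=> /andP[c0 c1] sq' sr' ssq ssr.
elim/tuple_rcons_ind: n / h => [|n h a IH]; first by rewrite !reach_prob0.
rewrite !reach_prob_rcons IH /splitting_strategy.
have q0 : 0 <= c * reach_prob q sq x h by rewrite mulr_ge0// reach_prob_ge0.
have r0 : 0 <= (1 - c) * reach_prob r sr x h.
  by rewrite mulr_ge0 ?subr_ge0// reach_prob_ge0.
set D := _ + _; have [D0|Dn0] := eqVneq D 0; last first.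
  by rewrite mulrC divfK// !mulrA.
have [E1 E2] : c * reach_prob q sq x h = 0 /\ (1 - c) * reach_prob r sr x h = 0.
  by move: D0; rewrite /D; split; lra.
by rewrite D0 mul0r (mulrA _ _ (sq x h _)) (mulrA _ _ (sr x h _)) E1 E2 !mul0r addr0.
Qed.

(** Under the splitting strategy the law of the plays is the mixture of the two
    laws, whatever P2 does, so that its guarantee is at least the mixture of the
    two guarantees. *)
Lemma game_value_concave (R : realType) (X I J : finType)
    (G : X -> I -> J -> R) k :
  (0 < #|I|)%N -> (0 < #|J|)%N -> concave_on_simplex (game_value G k).
Proof.
move=> I0 J0 q r c sq sr c01; have /andP[c0 c1] := c01.
apply/ler_addgt0Pr => e e0; rewrite -lerBlDr.
have [s ss Hs] := game_value_approx G k I0 J0 sq e0.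
have [s' ss' Hs'] := game_value_approx G k I0 J0 sr e0.
have sz := splitting_strategyP c01 sq sr ss ss'.
apply: (game_value_ge I0 J0 (simplex_convex sq sr c01) sz) => t st.
have -> : expected_payoff G (fun x => c * q x + (1 - c) * r x) k
    (splitting_strategy c q s r s') t =
    c * expected_payoff G q k s t + (1 - c) * expected_payoff G r k s' t.
  rewrite /expected_payoff !mulr_sumr -big_split/=; apply: eq_bigr => x _.
  rewrite !mulr_sumr -big_split/=; apply: eq_bigr => h _.
  by rewrite 3!play_probE reach_prob_splitting//; ring.
apply: (@le_trans _ _ (c * (game_value G k q - e) +
                       (1 - c) * (game_value G k r - e))).
  by rewrite le_eqVlt; apply/orP; left; apply/eqP; ring.
by apply: lerD; apply: ler_wpM2l; rewrite ?subr_ge0//; [exact: Hs|exact: Hs'].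
Qed.

Lemma nonrevealing_value_le (R : realType) (X I J : finType)
    (G : X -> I -> J -> R) q :
  (0 < #|I|)%N -> (0 < #|J|)%N -> simplex R X q ->
  nonrevealing_value G q <= payoff_norm G.
Proof.
move=> I0 J0 sq; have /card_gt0P[j0 _] := J0.
apply: (minmax_le I0 (simplex_dirac R j0)) => i.
apply: simplex_mean_le (simplex_dirac R j0) _ => j.
apply: simplex_mean_le => // x.
exact: le_trans (ler_norm _) (payoff_le_norm _ _ _ _).
Qed.

Lemma cav_le_game_value (R : realType) (X I J : finType)
    (G : X -> I -> J -> R) k p :
  (0 < #|I|)%N -> (0 < #|J|)%N -> (0 < k)%N -> simplex R X p ->
  cav (nonrevealing_value G) p <= game_value G k p.
Proof.
move=> I0 J0 k0 sp.
apply: (cavP (fun q sq => nonrevealing_value_le G I0 J0 sq)).2 => //.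
split; first exact: game_value_concave.
by move=> q sq; exact: nonrevealing_le_game_value.
Qed.

(** * Posteriors and the information revealed by P1 *)

(** After a history that P1 never produces, the prior is used so that the posterior is
    always a probability. *)
Definition posterior (R : realType) (X I J : finType) (p : X -> R)
    (s : X -> seq (I * J) -> I -> R) (h : seq (I * J)) (x : X) : R :=
  if \sum_y reach_prob p s y h == 0 then p x
  else reach_prob p s x h / \sum_y reach_prob p s y h.

Definition history_prob (R : realType) (X I J : finType) (p : X -> R) s
    (t : seq (I * J) -> J -> R) n (h : n.-tuple (I * J)) : R :=
  \sum_x play_prob p s t x h.

(** The expectation of minus the entropy of the posterior after n stages. *)
Definition neg_cond_entropy (R : realType) (X I J : finType) (p : X -> R) s
    (t : seq (I * J) -> J -> R) n : R :=
  \sum_(h : n.-tuple (I * J)) \sum_x play_prob p s t x h * ln (posterior p s h x).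

(** The l1 distance between the joint law of the history h, the action pair a of
    the stage n and the state x, and the law under which a and x are independent
    given h with the same conditional marginals. *)
Definition joint_product_dist (R : realType) (X I J : finType) (p : X -> R) s
    (t : seq (I * J) -> J -> R) n : R :=
  \sum_(h : n.-tuple (I * J)) \sum_a \sum_x
    `|play_prob p s t x (rcons_tuple h a) -
      history_prob p s t (rcons_tuple h a) * posterior p s h x|.

Lemma simplex_le1 (R : realType) (X : finType) (p : X -> R) x :
  simplex R X p -> p x <= 1.
Proof.
by move=> [p0 <-]; rewrite (bigD1 x)//= lerDl sumr_ge0.
Qed.

Lemma posterior_simplex (R : realType) (X I J : finType) (p : X -> R)
    (s : X -> seq (I * J) -> I -> R) (h : seq (I * J)) :
  simplex R X p -> strategies1 R X I J s -> simplex R X (posterior p s h).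
Proof.
move=> sp ss; rewrite /posterior.
have [_|Sn0] := eqVneq (\sum_y reach_prob p s y h) 0; first exact: sp.
split=> [x|] /=; last by rewrite -mulr_suml divff.
by rewrite divr_ge0 ?sumr_ge0// => *; exact: reach_prob_ge0.
Qed.

Lemma posterior_nil (R : realType) (X I J : finType) (p : X -> R)
    (s : X -> seq (I * J) -> I -> R) (h : 0.-tuple (I * J)) :
  simplex R X p -> posterior p s h = p.
Proof.
move=> sp; apply/funext => x; rewrite /posterior.
under eq_bigr do rewrite reach_prob0.
by rewrite sp.2 oner_eq0 divr1 reach_prob0.
Qed.

(** The factor of P2 in the probability of a play does not depend on the state, so
    it cancels in the conditional law of the state. *)
Lemma play_prob_posterior (R : realType) (X I J : finType) (p : X -> R) s
    (t : seq (I * J) -> J -> R) n (h : n.-tuple (I * J)) x :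
  simplex R X p -> strategies1 R X I J s ->
  play_prob p s t x h = history_prob p s t h * posterior p s h x.
Proof.
move=> sp ss; have -> : history_prob p s t h =
    (\sum_y reach_prob p s y h) * \prod_(m < n) t (take m h) (tnth h m).2.
  by rewrite mulr_suml; apply: eq_bigr => y _; exact: play_probE.
rewrite play_probE /posterior; case: ifPn => [S0|Sn0].
  have -> : reach_prob p s x h = 0.
    move: S0; rewrite psumr_eq0 => [/allP S0|*]; last exact: reach_prob_ge0.
    exact: eqP (S0 x (mem_index_enum x)).
  by rewrite (eqP S0) !mul0r.
by rewrite [RHS]mulrC [RHS]mulrA divfK.
Qed.

Lemma play_prob_strategies_ge0 (R : realType) (X I J : finType) (p : X -> R) s
    (t : seq (I * J) -> J -> R) n (h : n.-tuple (I * J)) x :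
  simplex R X p -> strategies1 R X I J s -> strategies2 R I J t ->
  0 <= play_prob p s t x h.
Proof.
move=> sp ss st; apply: play_prob_ge0 => [y|y g|g].
- exact: sp.1.
- exact: (ss y g).1.
- exact: (st g).1.
Qed.

Lemma history_prob_simplex (R : realType) (X I J : finType) (p : X -> R) s
    (t : seq (I * J) -> J -> R) n :
  simplex R X p -> strategies1 R X I J s -> strategies2 R I J t ->
  simplex R (n.-tuple (I * J)) (history_prob p s t (n := n)).
Proof.
move=> sp ss st; split=> [h|].
  by rewrite sumr_ge0// => x _; exact: play_prob_strategies_ge0.
rewrite /history_prob exchange_big -sp.2; apply: eq_bigr => x _.
exact: sum_play_prob.
Qed.

(** Pinsker's inequality on the triples (h, a, x).  The ratio of the two laws is
    the ratio of the posteriors after and before a, so that their relative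
    entropy, the mutual information of a and x given h, is the increase of
    neg_cond_entropy. *)
Lemma joint_product_dist_sqr_le (R : realType) (X I J : finType) (p : X -> R) s
    (t : seq (I * J) -> J -> R) n :
  simplex R X p -> strategies1 R X I J s -> strategies2 R I J t ->
  joint_product_dist p s t n ^+ 2 <=
  2 * (neg_cond_entropy p s t n.+1 - neg_cond_entropy p s t n).
Proof.
move=> sp ss st.
(* a is the joint law and b the product law. *)
pose T : finType := ((n.-tuple (I * J) * (I * J)) * X)%type.
pose a (z : T) := play_prob p s t z.2 (rcons_tuple z.1.1 z.1.2).
pose b (z : T) := history_prob p s t (rcons_tuple z.1.1 z.1.2) *
                  posterior p s z.1.1 z.2.
have sumT (F : n.-tuple (I * J) -> I * J -> X -> R) :
    \sum_(z : T) F z.1.1 z.1.2 z.2 = \sum_h \sum_c \sum_x F h c x.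
  rewrite pair_bigA/=.
  by rewrite (pair_bigA _ (fun (y : n.-tuple (I * J) * (I * J)) x => F y.1 y.2 x)).
have post h := posterior_simplex h sp ss.
have a0 z : 0 <= a z by exact: play_prob_strategies_ge0.
have b0 z : 0 <= b z.
  by rewrite mulr_ge0 ?(post _).1// (history_prob_simplex n.+1 sp ss st).1.
have aE z : a z = history_prob p s t (rcons_tuple z.1.1 z.1.2) *
    posterior p s (rcons_tuple z.1.1 z.1.2) z.2 by exact: play_prob_posterior.
have ab z : b z = 0 -> a z = 0.
  move=> /eqP; rewrite mulf_eq0 => /orP[/eqP W0|/eqP P0]; first by rewrite aE W0 mul0r.
  by rewrite /a play_prob_rcons play_prob_posterior// P0 mulr0 mul0r.
have a1 : \sum_z a z = 1.
  rewrite (sumT (fun h c x => play_prob p s t x (rcons_tuple h c))).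
  rewrite -(history_prob_simplex n.+1 sp ss st).2 big_tuple_rcons.
  by apply: eq_bigr.
have b1 : \sum_z b z = 1.
  rewrite (sumT (fun h c x => history_prob p s t (rcons_tuple h c) * posterior p s h x)).
  rewrite -(history_prob_simplex n.+1 sp ss st).2 big_tuple_rcons.
  apply: eq_bigr => h _; apply: eq_bigr => c _.
  by rewrite -mulr_sumr (post h).2 mulr1.
have := pinsker a0 b0 ab a1 b1.
rewrite (sumT (fun h c x => `|play_prob p s t x (rcons_tuple h c) -
   history_prob p s t (rcons_tuple h c) * posterior p s h x|)) -/(joint_product_dist p s t n).
suff -> : \sum_z a z * (ln (a z) - ln (b z)) =
  neg_cond_entropy p s t n.+1 - neg_cond_entropy p s t n by [].
pose f (h : n.-tuple (I * J)) c x := play_prob p s t x (rcons_tuple h c) *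
  (ln (posterior p s (rcons_tuple h c) x) - ln (posterior p s h x)).
transitivity (\sum_(z : T) f z.1.1 z.1.2 z.2).
  apply: eq_bigr => z _; rewrite /f -/(a z).
  have [->|an0] := eqVneq (a z) 0; first by rewrite !mul0r.
  congr (_ * _).
  have bn0 : b z != 0 by apply: contraNneq an0 => /ab ->.
  move: an0 bn0; rewrite aE /b !mulf_eq0 !negb_or => /andP[W0 P0] /andP[_ P0'].
  have pos (r : R) : 0 <= r -> r != 0 -> r \is Num.pos.
    by move=> r0 rn0; rewrite posrE lt_neqAle eq_sym rn0.
  have Wp := pos _ ((history_prob_simplex n.+1 sp ss st).1 _) W0.
  rewrite !lnM ?pos ?(post _).1 ?(history_prob_simplex n.+1 sp ss st).1//.
  by rewrite opprD addrACA subrr add0r.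
rewrite (sumT f) /f.
rewrite /neg_cond_entropy big_tuple_rcons -sumrB; apply: eq_bigr => h _.
rewrite [X in _ = _ - X](_ : _ = \sum_c \sum_x
    play_prob p s t x (rcons_tuple h c) * ln (posterior p s h x)).
  rewrite -sumrB; apply: eq_bigr => c _; rewrite -sumrB.
  by apply: eq_bigr => x _; rewrite mulrBr.
rewrite exchange_big; apply: eq_bigr => x _.
by rewrite -mulr_suml sum_play_prob_rcons.
Qed.

(** The increments telescope; the posterior has entropy H(p) at the start and a
    nonnegative entropy at the end. *)
Lemma sum_joint_product_dist_sqr (R : realType) (X I J : finType) (p : X -> R) s
    (t : seq (I * J) -> J -> R) k :
  simplex R X p -> strategies1 R X I J s -> strategies2 R I J t ->
  \sum_(n < k) joint_product_dist p s t n ^+ 2 <= 2 * entropy p.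
Proof.
move=> sp ss st.
have F0 : neg_cond_entropy p s t 0 = - entropy p.
  rewrite /neg_cond_entropy (bigD1 [tuple])//= [X in _ + X]big1 => [|h /eqP[]]; last exact: tuple0.
  rewrite addr0 /entropy opprK; apply: eq_bigr => x _.
  by rewrite play_prob0 posterior_nil.
have Fk : neg_cond_entropy p s t k <= 0.
  rewrite -oppr_ge0 -sumrN sumr_ge0// => h _; rewrite -sumrN sumr_ge0// => x _.
  rewrite -mulrN mulr_ge0 ?play_prob_strategies_ge0// oppr_ge0 ln_le0//.
  exact/simplex_le1/posterior_simplex.
apply: (@le_trans _ _ (2 * (neg_cond_entropy p s t k - neg_cond_entropy p s t 0))).
  elim: k {Fk} => [|k IH]; first by rewrite big_ord0 subrr mulr0.
  rewrite big_ord_recr/=; have := joint_product_dist_sqr_le k sp ss st; lra.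
by rewrite F0; lra.
Qed.

(** Under the product law P1 uses at h the mixed action a, the average of s x h
    over the posterior, against which t h is nearly optimal.  Passing from the
    joint law to the product law changes the payoff by at most the norm of G
    times their distance. *)
Lemma stage_payoff_le (R : realType) (X I J : finType)
    (G : X -> I -> J -> R) (p : X -> R) s (t : seq (I * J) -> J -> R) e n :
  simplex R X p -> strategies1 R X I J s -> strategies2 R I J t ->
  (forall h a, simplex R I a ->
    mixed_payoff (fun i j => \sum_x posterior p s h x * G x i j) a (t h) <=
    nonrevealing_value G (posterior p s h) + e) ->
  stage_payoff G p s t n <=
  \sum_(h : n.-tuple (I * J))
    history_prob p s t h * (nonrevealing_value G (posterior p s h) + e) +
  payoff_norm G * joint_product_dist p s t n.
Proof.
move=> sp ss st Ht; rewrite mulr_sumr -big_split/=; apply: ler_sum => h _.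
have post := posterior_simplex h sp ss.
set W := history_prob p s t h.
pose a i := \sum_x posterior p s h x * s x h i.
have sa : simplex R I a.
  split=> [i|]; first by rewrite sumr_ge0// => x _; rewrite mulr_ge0 ?post.1// (ss x h).1.
  rewrite exchange_big -post.2; apply: eq_bigr => x _.
  by rewrite -mulr_sumr (ss x h).2 mulr1.
have W0 : 0 <= W by exact: (history_prob_simplex n sp ss st).1.
have WE c : history_prob p s t (rcons_tuple h c) = W * (a c.1 * t h c.2).
  rewrite /history_prob /a mulr_suml mulr_sumr; apply: eq_bigr => x _.
  by rewrite play_prob_rcons play_prob_posterior// -/W; ring.
apply: (@le_trans _ _
  (W * mixed_payoff (fun i j => \sum_x posterior p s h x * G x i j) a (t h) +
   payoff_norm G * \sum_c \sum_x
    `|play_prob p s t x (rcons_tuple h c) -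
      history_prob p s t (rcons_tuple h c) * posterior p s h x|)); last first.
  by rewrite lerD2r ler_wpM2l// Ht.
have -> : W * mixed_payoff (fun i j => \sum_x posterior p s h x * G x i j) a (t h) =
    \sum_c \sum_x history_prob p s t (rcons_tuple h c) * posterior p s h x * G x c.1 c.2.
  rewrite sum_action_pairs mulr_sumr; apply: eq_bigr => i _.
  rewrite mulr_sumr; apply: eq_bigr => j _; rewrite WE mulr_sumr mulr_suml mulr_sumr.
  by apply: eq_bigr => x _ /=; ring.
rewrite mulr_sumr -big_split/=; apply: ler_sum => c _.
rewrite mulr_sumr -big_split/=; apply: ler_sum => x _.
rewrite -lerBlDl -mulrBl; apply: le_trans (ler_norm _) _.
by rewrite normrM mulrC ler_wpM2r// payoff_le_norm.
Qed.

(** The variance is nonnegative. *)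
Lemma mean_sqr_le (R : realType) (k : nat) (f : 'I_k -> R) : (0 < k)%N ->
  (k%:R^-1 * \sum_n f n) ^+ 2 <= k%:R^-1 * \sum_n f n ^+ 2.
Proof.
move=> k0; have kp : 0 < k%:R :> R by rewrite ltr0n.
set m := _ * _.
have Em : \sum_n f n = k%:R * m by rewrite /m mulVKf ?gt_eqF.
have : 0 <= \sum_n (f n - m) ^+ 2 by rewrite sumr_ge0// => n _; exact: sqr_ge0.
have -> : \sum_n (f n - m) ^+ 2 = \sum_n f n ^+ 2 - k%:R * m ^+ 2.
  have E n : (f n - m) ^+ 2 = f n ^+ 2 - 2 * m * f n + m ^+ 2 by ring.
  under eq_bigr do rewrite E.
  rewrite big_split/= sumrB -mulr_sumr Em sumr_const card_ord -mulr_natl.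
  by ring.
by rewrite subr_ge0 => H; rewrite [leRHS]mulrC ler_pdivlMr// mulrC.
Qed.

(** * Comparison with the concavification *)

Lemma game_value_le_cav (R : realType) (X I J : finType)
    (G : X -> I -> J -> R) (p : X -> R) k :
  (0 < #|I|)%N -> (0 < #|J|)%N -> (0 < k)%N -> simplex R X p ->
  game_value G k p <= cav (nonrevealing_value G) p +
    payoff_norm G * Num.sqrt (2 * entropy p / k%:R).
Proof.
move=> I0 J0 k0 sp; have kp : 0 < k%:R :> R by rewrite ltr0n.
apply/ler_addgt0Pr => e e0; apply: (game_value_le I0 J0 sp) => s ss.
pose A (q : X -> R) i j := \sum_x q x * G x i j.
have /choice[b Hb] : forall q, exists b, simplex R J b /\
    forall a, simplex R I a -> mixed_payoff (A q) a b <= nonrevealing_value G q + e.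
  by move=> q; have [b sb Hb] := minmax_approx (A q) I0 J0 e0; exists b.
pose t h := b (posterior p s h).
have st : strategies2 R I J t by move=> h; exact: (Hb _).1.
exists t => //; rewrite expected_payoffE//.
have [[cavc cavu] _] := cavP (fun q sq => nonrevealing_value_le G I0 J0 sq).
have stage n : stage_payoff G p s t n <=
    cav (nonrevealing_value G) p + e + payoff_norm G * joint_product_dist p s t n.
  apply: le_trans (stage_payoff_le (e := e) n sp ss st _) _.
    by move=> h a sa; exact: (Hb _).2.
  rewrite lerD2r; have sW := history_prob_simplex n sp ss st.
  under eq_bigr do rewrite mulrDr.
  rewrite big_split/= -mulr_suml sW.2 mul1r lerD2r.
  have post (h : n.-tuple (I * J)) := posterior_simplex h sp ss.
  apply: (@le_trans _ _ (\sum_(h : n.-tuple (I * J)) history_prob p s t h *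
      cav (nonrevealing_value G) (posterior p s h))).
    by apply: ler_sum => h _; rewrite ler_wpM2l ?sW.1// cavu.
  apply: le_trans (concave_jensen cavc sW post) _.
  rewrite le_eqVlt; apply/orP; left; apply/eqP; congr cav; apply/funext => x.
  rewrite -(sum_play_prob p x n ss st); apply: eq_bigr => h _.
  by rewrite -play_prob_posterior.
apply: (@le_trans _ _ (k%:R^-1 * \sum_(n < k)
    (cav (nonrevealing_value G) p + e + payoff_norm G * joint_product_dist p s t n))).
  by rewrite ler_wpM2l ?invr_ge0 ?(ltW kp)// ler_sum.
rewrite big_split/= sumr_const card_ord -[(_ + e) *+ k]mulr_natl mulrDr mulKf ?gt_eqF//.
rewrite addrAC lerD2r lerD2l -mulr_sumr mulrCA ler_wpM2l ?payoff_norm_ge0//.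
apply: le_trans (ler_norm _) _; rewrite -sqrtr_sqr ler_wsqrtr//.
apply: le_trans (mean_sqr_le _ k0) _.
by rewrite mulrC ler_wpM2r ?invr_ge0 ?(ltW kp)// sum_joint_product_dist_sqr.
Qed.

Theorem mainTheorem4 (R : realType) (X I J : finType) (d : nat)
    (p : X -> R) (G : X -> I -> J -> R)
    (cardX : #|X| = d) (I_gt0 : (0 < #|I|)%N) (J_gt0 : (0 < #|J|)%N)
    (p_prob : simplex R X p) :
  (forall k : nat, (0 < k)%N ->
     game_value G k p - cav (nonrevealing_value G) p <=
       payoff_norm G * Num.sqrt (2 * entropy p / k%:R) /\
     payoff_norm G * Num.sqrt (2 * entropy p / k%:R) <=
       payoff_norm G * Num.sqrt (2 * ln (d%:R : R) / k%:R)) /\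
  game_value G n p @[n --> \oo] --> cav (nonrevealing_value G) p.
Proof.
split=> [k k0|].
  split; first by rewrite lerBlDl; exact: game_value_le_cav.
  rewrite ler_wpM2l ?payoff_norm_ge0// ler_wsqrtr// ler_wpM2r ?invr_ge0//.
  by rewrite ler_wpM2l// -cardX; exact: entropy_le_ln_card.
(* The two bounds hold from the first stage on, hence the shift by one. *)
rewrite -cvg_shiftS /=.
pose bound n := cav (nonrevealing_value G) p +
  payoff_norm G * Num.sqrt (2 * entropy p / n.+1%:R).
apply: (@squeeze_cvgr _ _ _ _ (fun=> cav (nonrevealing_value G) p) bound).
- near=> n; rewrite cav_le_game_value//=.
  exact: game_value_le_cav.
- exact: cvg_cst.
rewrite -[X in _ --> X]addr0; apply: cvgD; first exact: cvg_cst.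
rewrite -[X in _ --> X](mulr0 (payoff_norm G)); apply: cvgM; first exact: cvg_cst.
rewrite -[X in _ --> X](@sqrtr0 R); apply: continuous_cvg; first exact: sqrt_continuous.
rewrite -[X in _ --> X](mulr0 (2 * entropy p)); apply: cvgM; first exact: cvg_cst.
exact: cvg_harmonic.
Unshelve. all: by end_near. Qed.
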